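(* Let the Domb numbers $D_n$ be defined by $D_0=1$, $D_1=4$ and $n^3D_n=2(2n-1)(5n^2-5n+2)D_{n-1}-64(n-1)^3D_{n-2}$ for $n\geq 2$. The sequence $\{D_n\}_{n\geq 0}$ is ratio log-concave, and the sequence $\{\sqrt[n]{D_n}\}_{n\geq 1}$ is strictly log-concave.
   Context: A sequence $(x_n)_{n\ge m}$ of positive reals is log-concave if $x_n^2\ge x_{n-1}x_{n+1}$ for all $n\ge m+1$, strictly log-concave if the inequality is strict. A sequence $(a_n)_{n\ge m}$ of positive reals is ratio log-concave if $(a_{n+1}/a_n)_{n\ge m}$ is log-concave. *)

(* Defs.v *)
From Stdlib Require Import Reals.
Open Scope R_scope.

(* A sequence (x_n)_{n >= m} is a total function nat -> R whose values at
   indices below m are ignored. *)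
Definition positive_from (m : nat) (x : nat -> R) : Prop :=
  forall n : nat, (m <= n)%nat -> 0 < x n.

Definition log_concave_from (m : nat) (x : nat -> R) : Prop :=
  positive_from m x /\
  forall n : nat, (m + 1 <= n)%nat -> x n ^ 2 >= x (n - 1)%nat * x (n + 1)%nat.

Definition strictly_log_concave_from (m : nat) (x : nat -> R) : Prop :=
  positive_from m x /\
  forall n : nat, (m + 1 <= n)%nat -> x n ^ 2 > x (n - 1)%nat * x (n + 1)%nat.

Definition ratio_log_concave_from (m : nat) (a : nat -> R) : Prop :=
  positive_from m a /\
  log_concave_from m (fun n => a (n + 1)%nat / a n).

(* The positive n-th root, meaningful for 1 <= n and 0 < x. *)
Definition nth_root (n : nat) (x : R) : R := Rpower x (/ INR n).

(* The recurrence determines D uniquely, since n^3 <> 0 for n >= 2. *)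
Definition is_Domb (D : nat -> R) : Prop :=
  D 0%nat = 1 /\ D 1%nat = 4 /\
  forall n : nat, (2 <= n)%nat ->
    INR n ^ 3 * D n =
      2 * (2 * INR n - 1) * (5 * INR n ^ 2 - 5 * INR n + 2) * D (n - 1)%nat
      - 64 * (INR n - 1) ^ 3 * D (n - 2)%nat.

Fixpoint Domb_pair (n : nat) : R * R :=
  match n with
  | O => (1, 4)
  | S k =>
      let (u, v) := Domb_pair k in
      let t := INR (k + 2) in
      (v, (2 * (2 * t - 1) * (5 * t ^ 2 - 5 * t + 2) * v
           - 64 * (t - 1) ^ 3 * u) / t ^ 3)
  end.

Lemma is_Domb_inhabited : is_Domb (fun n => fst (Domb_pair n)).
Proof.
  assert (H : forall k, fst (Domb_pair (S k)) = snd (Domb_pair k)).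
  { intro k; simpl; destruct (Domb_pair k); reflexivity. }
  split; [reflexivity | split; [reflexivity |]].
  intros [|[|k]] Hn; [inversion Hn | inversion Hn as [|? H0]; inversion H0 |].
  replace (S (S k) - 1)%nat with (S k) by (simpl; reflexivity).
  replace (S (S k) - 2)%nat with k by (destruct k; reflexivity).
  rewrite !H; cbn [Domb_pair]; destruct (Domb_pair k) as [u v]; cbn [fst snd].
  replace (k + 2)%nat with (S (S k)) by (rewrite Nat.add_comm; reflexivity).
  field; apply not_0_INR; discriminate.
Qed.

(* Main.v *)
Require Import Defs.
From Stdlib Require Import Reals Lra Lia.
Open Scope R_scope.

(** Put [r n = D (n+1) / D n].  The recurrence reads [r n = a n - b n / r (n-1)],
    which is increasing in [r (n-1)], so truncations of the asymptotic expansion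
    [16 - 24/n + 36/n^2 - 54/n^3 + 69/n^4 - ...] of [r n] propagate as lower and
    upper bounds by induction.  They are sharp enough to give
    [(r n)^2 >= r (n-1) * r (n+1)] for [n >= 6]; smaller [n] are computed.

    For the roots, write [E n] for [n (n-1) (n+1)] times minus the second
    difference of [ln (D n) / n].  Then [E (n+1) - E n] is [n (n+1)] times minus
    the second difference of [ln (r n)], hence nonnegative, and it only remains
    to see that [E 1 = - 2 ln (D 0)] and [E 2 > E 1]. *)

Lemma ln_le_compat (x y : R) : 0 < x -> x <= y -> ln x <= ln y.
Proof.
  intros Hx [H | ->]; [left; now apply ln_increasing | right; reflexivity].
Qed.

Lemma log_concave_ln (u v w : R) :
  0 < u -> 0 < v -> 0 < w -> v ^ 2 >= u * w -> 2 * ln v >= ln u + ln w.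
Proof.
  intros Hu Hv Hw H.
  replace (2 * ln v) with (ln (v ^ 2)) by (rewrite ln_pow by assumption; simpl; ring).
  rewrite <- ln_mult by assumption.
  apply Rle_ge, ln_le_compat; [now apply Rmult_lt_0_compat | lra].
Qed.

Lemma strict_log_concave_ln (u v w : R) :
  0 < u -> 0 < v -> 0 < w -> v ^ 2 > u * w -> 2 * ln v > ln u + ln w.
Proof.
  intros Hu Hv Hw H.
  replace (2 * ln v) with (ln (v ^ 2)) by (rewrite ln_pow by assumption; simpl; ring).
  rewrite <- ln_mult by assumption.
  apply ln_increasing; [now apply Rmult_lt_0_compat | lra].
Qed.

(** * Strict log-concavity of roots, for a general ratio log-concave sequence *)

Section RootLogConcavity.

Variable a : nat -> R.
Hypothesis ratio_lc : ratio_log_concave_from 0 a.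
Hypothesis a0_le1 : a 0%nat <= 1.
Hypothesis strict_start : (a 2%nat / a 1%nat) ^ 2 > (a 1%nat / a 0%nat) * (a 3%nat / a 2%nat).

Let a_pos (n : nat) : 0 < a n.
Proof. apply (proj1 ratio_lc); lia. Qed.

Let ratio_pos (n : nat) : 0 < a (S n) / a n.
Proof. now apply Rdiv_lt_0_compat. Qed.

Let ln_ratio (n : nat) : ln (a (S n) / a n) = ln (a (S n)) - ln (a n).
Proof.
  unfold Rdiv; rewrite ln_mult, ln_Rinv; [ring | auto | auto | now apply Rinv_0_lt_compat].
Qed.

(** This is [E (n+1)] with denominators cleared, hence meaningful also at [n = 0], where the second
    difference would involve [ln (a 0) / 0]. *)
Let defect (n : nat) : R :=
  - 2 * ln (a (S n)) + (INR n + 1) * (INR n + 2) * ln (a (S n) / a n)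
  - (INR n + 1) * INR n * ln (a (S (S n)) / a (S n)).

Let defect_step (n : nat) :
  defect (S n) - defect n =
  (INR n + 1) * (INR n + 2) *
  (2 * ln (a (S (S n)) / a (S n)) - ln (a (S n) / a n) - ln (a (S (S (S n))) / a (S (S n)))).
Proof. unfold defect; rewrite !ln_ratio, S_INR; ring. Qed.

(** Strictness enters in the first step: [defect 0] may vanish, but [strict_start] makes [defect 1]
    exceed it. Every later step is nonnegative by ratio log-concavity. *)
Let defect_pos (n : nat) : 0 < defect (S n).
Proof.
  induction n as [|n IH].
  - assert (L0 : ln (a 0%nat) <= 0) by (rewrite <- ln_1; apply ln_le_compat; auto).
    pose proof (defect_step 0) as E1.
    assert (E0 : defect 0 = - 2 * ln (a 0%nat)) by (unfold defect; rewrite !ln_ratio; simpl; ring).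
    pose proof (strict_log_concave_ln _ _ _ (ratio_pos 0) (ratio_pos 1) (ratio_pos 2) strict_start).
    simpl INR in E1; lra.
  - pose proof (defect_step (S n)) as E1.
    pose proof (proj2 (proj2 ratio_lc) (S (S n)) ltac:(lia)) as H; cbv beta in H.
    replace (S (S n) + 1)%nat with (S (S (S n))) in H by lia.
    replace (S (S n) - 1 + 1)%nat with (S (S n)) in H by lia.
    replace (S (S n) - 1)%nat with (S n) in H by lia.
    replace (S (S (S n)) + 1)%nat with (S (S (S (S n)))) in H by lia.
    apply log_concave_ln in H; try apply ratio_pos.
    assert (0 <= (INR (S n) + 1) * (INR (S n) + 2))
      by (pose proof (pos_INR (S n)); apply Rmult_le_pos; lra).
    assert (0 <= defect (S (S n)) - defect (S n))
      by (rewrite E1; apply Rmult_le_pos; lra).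
    lra.
Qed.

Lemma root_strictly_log_concave : strictly_log_concave_from 1 (fun n => nth_root n (a n)).
Proof.
  split; [intros n _; apply exp_pos |].
  intros n Hn; unfold nth_root, Rpower.
  destruct n as [|[|k]]; [lia | lia |].
  replace (S (S k) - 1)%nat with (S k) by lia.
  replace (S (S k) + 1)%nat with (S (S (S k))) by lia.
  rewrite <- Rsqr_pow2; unfold Rsqr; rewrite <- !exp_plus.
  apply exp_increasing, Rlt_0_minus.
  pose proof (defect_pos k) as H; unfold defect in H; rewrite !ln_ratio in H.
  pose proof (pos_INR k) as Hk.
  rewrite !S_INR in *.
  set (x := INR k) in *.
  (* The numerator is [defect (S k)]; the denominator is [(n-1) n (n+1)] at [n = k + 2]. *)
  match goal with |- 0 < ?g => replace g with
    ((- 2 * ln (a (S (S k))) + (x + 1 + 1) * (x + 1 + 2) * (ln (a (S (S k))) - ln (a (S k)))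
      - (x + 1 + 1) * (x + 1) * (ln (a (S (S (S k)))) - ln (a (S (S k)))))
     / ((x + 1) * (x + 2) * (x + 3))) by (field; lra) end.
  apply Rdiv_lt_0_compat; [exact H |].
  repeat apply Rmult_lt_0_compat; lra.
Qed.

End RootLogConcavity.

(** * Polynomial inequalities for the truncated expansions *)

(* The truncations of the expansion of [r n], multiplied by [n^3] and [n^4]. *)
Definition ratio_lower (x : R) : R := 16 * x ^ 3 - 24 * x ^ 2 + 36 * x - 54.
Definition ratio_upper (x : R) : R := 16 * x ^ 4 - 24 * x ^ 3 + 36 * x ^ 2 - 54 * x + 69.

Ltac nonneg_coefficients :=
  repeat first
    [ assumption
    | apply Rplus_le_le_0_compat
    | apply Rmult_le_pos
    | apply pow_le
    | lra ].

(* Proves [p x <= q x] for [x >= c] by expanding [q - p] in powers of [x - c]. *)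
Ltac poly_le_from x c :=
  let t := fresh "t" in
  let Ht := fresh "Ht" in
  apply Rge_le, Rminus_ge, Rle_ge;
  assert (Ht : 0 <= x - c) by lra;
  set (t := x - c) in Ht;
  replace x with (t + c) by (unfold t; ring);
  clearbody t;
  match goal with |- 0 <= ?e => ring_simplify e end;
  nonneg_coefficients.

Lemma ratio_lower_pos (x : R) : 3 <= x -> 0 < ratio_lower x.
Proof.
  (* Going through 1 leaves a non-strict inequality, as [poly_le_from] requires. *)
  intro Hx; unfold ratio_lower; apply Rlt_le_trans with 1; [lra |].
  poly_le_from x 3.
Qed.

Lemma ratio_upper_pos (x : R) : 3 <= x -> 0 < ratio_upper x.
Proof.
  intro Hx; unfold ratio_upper; apply Rlt_le_trans with 1; [lra |].
  poly_le_from x 3.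
Qed.

(** Inserting [r n >= ratio_lower x / x^3] at [x = n] into the recurrence must give the same bound
    at [x + 1]; this is that requirement without denominators. *)
Lemma ratio_lower_step (x : R) : 3 <= x ->
  64 * (x + 1) ^ 6 * x ^ 3 <=
  ((x + 1) ^ 3 * (2 * (2 * x + 3) * (5 * (x + 1) ^ 2 + 5 * (x + 1) + 2))
   - ratio_lower (x + 1) * (x + 2) ^ 3) * ratio_lower x.
Proof. intro Hx; unfold ratio_lower; poly_le_from x 3. Qed.

Lemma ratio_upper_step (x : R) : 3 <= x ->
  ((x + 1) ^ 4 * (2 * (2 * x + 3) * (5 * (x + 1) ^ 2 + 5 * (x + 1) + 2))
   - ratio_upper (x + 1) * (x + 2) ^ 3) * ratio_upper x <=
  64 * (x + 1) ^ 7 * x ^ 4.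
Proof. intro Hx; unfold ratio_upper; poly_le_from x 3. Qed.

(** The bounds differ by only [69/x^4], while the log-concavity margin coming from [16 - 24/x] has
    order [x^-3]. The inequality fails at [x = 5], hence the threshold. *)
Lemma ratio_bounds_log_concave (x : R) : 6 <= x ->
  ratio_upper (x - 1) / (x - 1) ^ 4 * (ratio_upper (x + 1) / (x + 1) ^ 4)
  <= (ratio_lower x / x ^ 3) ^ 2.
Proof.
  intro Hx.
  assert (H1 : 0 < (x - 1) ^ 4 * (x + 1) ^ 4) by (apply Rmult_lt_0_compat; apply pow_lt; lra).
  assert (H2 : 0 < x ^ 6) by (apply pow_lt; lra).
  replace (ratio_upper (x - 1) / (x - 1) ^ 4 * (ratio_upper (x + 1) / (x + 1) ^ 4))
    with (ratio_upper (x - 1) * ratio_upper (x + 1) * x ^ 6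
          / ((x - 1) ^ 4 * (x + 1) ^ 4 * x ^ 6)) by (field; lra).
  replace ((ratio_lower x / x ^ 3) ^ 2)
    with (ratio_lower x ^ 2 * ((x - 1) ^ 4 * (x + 1) ^ 4)
          / ((x - 1) ^ 4 * (x + 1) ^ 4 * x ^ 6)) by (field; lra).
  apply Rmult_le_compat_r; [left; apply Rinv_0_lt_compat, Rmult_lt_0_compat; assumption |].
  unfold ratio_upper, ratio_lower; poly_le_from x 6.
Qed.

(** * Bounds and log-concavity for the ratios of Domb numbers *)

Section DombNumbers.

Variable D : nat -> R.
Hypothesis hD : is_Domb D.

Lemma Domb_rec (n : nat) :
  (INR n + 2) ^ 3 * D (S (S n)) =
  2 * (2 * INR n + 3) * (5 * (INR n + 1) ^ 2 + 5 * (INR n + 1) + 2) * D (S n)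
  - 64 * (INR n + 1) ^ 3 * D n.
Proof.
  pose proof (proj2 (proj2 hD) (S (S n)) ltac:(lia)) as H.
  replace (S (S n) - 1)%nat with (S n) in H by lia.
  replace (S (S n) - 2)%nat with n in H by lia.
  rewrite !S_INR in H.
  replace (INR n + 2) with (INR n + 1 + 1) by ring.
  rewrite H; ring.
Qed.

(** The last case checked by computation is centred at [r 5] and involves [r 6 = D 7 / D 6]. *)
Lemma Domb_values :
  D 0%nat = 1 /\ D 1%nat = 4 /\ D 2%nat = 28 /\ D 3%nat = 256 /\ D 4%nat = 2716 /\
  D 5%nat = 31504 /\ D 6%nat = 387136 /\ D 7%nat = 4951552.
Proof.
  destruct hD as [H0 [H1 _]].
  pose proof (Domb_rec 0) as H2; pose proof (Domb_rec 1) as H3.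
  pose proof (Domb_rec 2) as H4; pose proof (Domb_rec 3) as H5.
  pose proof (Domb_rec 4) as H6; pose proof (Domb_rec 5) as H7.
  rewrite !INR_IZR_INZ in *; simpl Z.of_nat in *.
  rewrite H0, H1 in H2; assert (E2 : D 2%nat = 28) by lra.
  rewrite H1, E2 in H3; assert (E3 : D 3%nat = 256) by lra.
  rewrite E2, E3 in H4; assert (E4 : D 4%nat = 2716) by lra.
  rewrite E3, E4 in H5; assert (E5 : D 5%nat = 31504) by lra.
  rewrite E4, E5 in H6; assert (E6 : D 6%nat = 387136) by lra.
  rewrite E5, E6 in H7; assert (E7 : D 7%nat = 4951552) by lra.
  repeat split; assumption.
Qed.

(** The recurrence has a negative term, so positivity is carried through the induction: it passes to
    [D (S n)] by the lower bound. *)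
Lemma Domb_ratio_bounds_mul (n : nat) : (3 <= n)%nat ->
  0 < D n /\
  ratio_lower (INR n) * D n <= INR n ^ 3 * D (S n) /\
  INR n ^ 4 * D (S n) <= ratio_upper (INR n) * D n.
Proof.
  induction 1 as [|n Hn [Hpos [Hlo Hup]]].
  - destruct Domb_values as (_ & _ & _ & E3 & E4 & _).
    rewrite E3, E4; unfold ratio_lower, ratio_upper; simpl INR; lra.
  - assert (Hx : 3 <= INR n) by (apply le_INR in Hn; simpl in Hn; lra).
    pose proof (Domb_rec n) as Hrec.
    pose proof (ratio_lower_step _ Hx) as Slo.
    pose proof (ratio_upper_step _ Hx) as Sup.
    pose proof (ratio_lower_pos _ Hx) as Plo.
    pose proof (ratio_upper_pos _ Hx) as Pup.
    rewrite S_INR.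
    set (x := INR n) in *; clearbody x.
    assert (Hx3 : 0 < x ^ 3) by (apply pow_lt; lra).
    assert (Hpos' : 0 < D (S n)).
    { apply Rmult_lt_reg_l with (x ^ 3); [assumption |].
      rewrite Rmult_0_r; apply Rlt_le_trans with (2 := Hlo).
      now apply Rmult_lt_0_compat. }
    assert (Hy : 0 < (x + 2) ^ 3) by (apply pow_lt; lra).
    split; [assumption | split].
    + apply Rmult_le_reg_l with ((x + 2) ^ 3 * ratio_lower x);
        [now apply Rmult_lt_0_compat |].
      replace ((x + 2) ^ 3 * ratio_lower x * ((x + 1) ^ 3 * D (S (S n))))
        with ((x + 1) ^ 3 * ratio_lower x * ((x + 2) ^ 3 * D (S (S n)))) by ring.
      rewrite Hrec.
      (* [F2] bounds the subtracted [D n] term by a multiple of [D (S n)], and [F1] compares the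
         coefficients of [D (S n)]. *)
      assert (F1 := Rmult_le_compat_r (D (S n)) _ _ (Rlt_le _ _ Hpos') Slo).
      assert (F2 := Rmult_le_compat_l (64 * (x + 1) ^ 6) _ _ ltac:(nonneg_coefficients) Hlo).
      lra.
    + apply Rmult_le_reg_l with ((x + 2) ^ 3 * ratio_upper x);
        [now apply Rmult_lt_0_compat |].
      replace ((x + 2) ^ 3 * ratio_upper x * ((x + 1) ^ 4 * D (S (S n))))
        with ((x + 1) ^ 4 * ratio_upper x * ((x + 2) ^ 3 * D (S (S n)))) by ring.
      rewrite Hrec.
      assert (F1 := Rmult_le_compat_r (D (S n)) _ _ (Rlt_le _ _ Hpos') Sup).
      assert (F2 := Rmult_le_compat_l (64 * (x + 1) ^ 7) _ _ ltac:(nonneg_coefficients) Hup).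
      lra.
Qed.

Lemma Domb_pos (n : nat) : 0 < D n.
Proof.
  destruct Domb_values as (E0 & E1 & E2 & _).
  destruct n as [|[|[|n]]]; [lra | lra | lra |].
  apply Domb_ratio_bounds_mul; lia.
Qed.

Lemma Domb_ratio_bounds (n : nat) : (3 <= n)%nat ->
  ratio_lower (INR n) / INR n ^ 3 <= D (S n) / D n <= ratio_upper (INR n) / INR n ^ 4.
Proof.
  intro Hn; destruct (Domb_ratio_bounds_mul n Hn) as [Hpos [Hlo Hup]].
  assert (Hx : 3 <= INR n) by (apply le_INR in Hn; simpl in Hn; lra).
  set (x := INR n) in *; clearbody x.
  assert (H3 : 0 < x ^ 3) by (apply pow_lt; lra).
  assert (H4 : 0 < x ^ 4) by (apply pow_lt; lra).
  split.
  - apply Rmult_le_reg_l with (x ^ 3 * D n); [now apply Rmult_lt_0_compat |].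
    field_simplify; lra.
  - apply Rmult_le_reg_l with (x ^ 4 * D n); [now apply Rmult_lt_0_compat |].
    field_simplify; lra.
Qed.

Lemma Domb_ratio_log_concave : ratio_log_concave_from 0 D.
Proof.
  split; [intros n _; apply Domb_pos | split].
  { intros n _; apply Rdiv_lt_0_compat; apply Domb_pos. }
  intros n Hn.
  destruct n as [|n]; [lia |].
  replace (S n - 1)%nat with n by lia.
  replace (n + 1)%nat with (S n) by lia.
  replace (S n + 1)%nat with (S (S n)) by lia.
  replace (S (S n) + 1)%nat with (S (S (S n))) by lia.
  (* The middle ratio has index [S n], so [5 <= n] matches the threshold 6 of
     [ratio_bounds_log_concave]. *)
  destruct (Nat.le_gt_cases 5 n) as [H5 | H5].
  - destruct (Domb_ratio_bounds n ltac:(lia)) as [_ U0].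
    destruct (Domb_ratio_bounds (S n) ltac:(lia)) as [L1 _].
    destruct (Domb_ratio_bounds (S (S n)) ltac:(lia)) as [_ U2].
    assert (Hx : 6 <= INR (S n)) by (replace 6 with (INR 6) by (simpl; ring); apply le_INR; lia).
    pose proof (ratio_bounds_log_concave _ Hx) as H.
    replace (INR (S n) - 1) with (INR n) in H by (rewrite S_INR; ring).
    rewrite <- S_INR in H.
    assert (L0 : 0 <= ratio_lower (INR (S n)) / INR (S n) ^ 3).
    { left; apply Rdiv_lt_0_compat; [apply ratio_lower_pos; lra | apply pow_lt; lra]. }
    pose proof (pow_incr _ _ 2 (conj L0 L1)) as Hsq.
    apply Rle_ge, Rle_trans with (2 := Rle_trans _ _ _ H Hsq).
    apply Rmult_le_compat; [| | exact U0 | exact U2];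
      left; apply Rdiv_lt_0_compat; apply Domb_pos.
  - destruct Domb_values as (E0 & E1 & E2 & E3 & E4 & E5 & E6 & E7).
    do 5 (destruct n as [|n]; [rewrite ?E0, ?E1, ?E2, ?E3, ?E4, ?E5, ?E6, ?E7; lra |]).
    lia.
Qed.

End DombNumbers.

Theorem theorem4p9 (D : nat -> R) (hD : is_Domb D) :
  ratio_log_concave_from 0 D /\
  strictly_log_concave_from 1 (fun n => nth_root n (D n)).
Proof.
  pose proof (Domb_ratio_log_concave D hD) as H.
  destruct (Domb_values D hD) as (E0 & E1 & E2 & E3 & _).
  split; [exact H |].
  apply root_strictly_log_concave; [exact H | lra |].
  rewrite E0, E1, E2, E3; lra.
Qed.
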